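(* Let $H$ be a complex Hilbert space with inner product $\langle\cdot,\cdot\rangle$ and norm $|\cdot|$, and let $-A$ be the generator of a uniformly bounded holomorphic semigroup $e^{-tA}$ in $H$. Then the following are equivalent: (i) for every $x\in D(A^2)$ with $|x|=1$, $2\big(\operatorname{Re}\langle Ax,x\rangle\big)^2\le \operatorname{Re}\langle A^2x,x\rangle+|Ax|^2$; (ii) for every $u_0\in H$ with $u_0\neq0$, the height function $h(t)=|e^{-tA}u_0|$ is log-convex on $[0,\infty[$, that is, for all $0\le r<s<t$, $|e^{-sA}u_0|\le |e^{-rA}u_0|^{\frac{t-s}{t-r}}|e^{-tA}u_0|^{\frac{s-r}{t-r}}$. Furthermore, if in addition to (i) and (ii) the operator $A$ is positively accretive, i.e. $\nu(A)\subset\{z\in\mathbb{C}:\operatorname{Re}z>0\}$, then for every $u_0\neq0$ the function $h(t)=|e^{-tA}u_0|$ is strictly decreasing (hence strictly convex) on $[0,\infty[$ and differentiable from the right at $t=0$ with derivative $h'(0)\in[-\infty,0]$, and for $|u_0|=1$ one has $h'(0)=\inf_{t>0}h'(t)\le -m(A)$. If moreover $u_0\in D(A)$ with $|u_0|=1$, then $h'(0)=-\operatorname{Re}\langle Au_0,u_0\rangle$ and $h\in C^1([0,\infty[,\mathbb{R})\cap C^\infty(]0,\infty[,\mathbb{R})$.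
   Context: A semigroup $e^{-tA}$ in $\mathbb{B}(H)$ is uniformly bounded if $\|e^{-tA}\|\le M$ for all $t\ge0$ and some constant $M$; it is holomorphic if it extends to a holomorphic family $e^{-zA}$ for $z$ in an open sector $\Sigma_\delta=\{z\in\mathbb{C}: |\arg z|<\delta\}$ for some $\delta>0$. The numerical range of $A$ is $\nu(A)=\{\langle Ax,x\rangle: x\in D(A),\ |x|=1\}$ and its lower bound is $m(A)=\inf\operatorname{Re}\nu(A)$. *)

(* Defs.v *)
From mathcomp Require Import all_boot all_order all_algebra.
From mathcomp Require Import all_classical all_reals all_analysis.
From mathcomp.real_closed Require Export complex.
Import Order.TTheory GRing.Theory Num.Theory.
Import numFieldNormedType.Exports.
Local Open Scope classical_set_scope.
Local Open Scope ring_scope.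

Set Implicit Arguments.
Unset Strict Implicit.
Unset Printing Implicit Defensive.

Definition is_inner_product (R : realType) (V : lmodType R[i])
    (ip : V -> V -> R[i]) : Prop :=
  [/\ forall (a : R[i]) (x y z : V), ip (a *: x + y) z = a * ip x z + ip y z,
      forall x y : V, ip y x = (ip x y)^*,
      forall x : V, 0 <= ip x x
    & forall x : V, ip x x = 0 -> x = 0].

Definition hnorm (R : realType) (V : lmodType R[i]) (ip : V -> V -> R[i])
    (x : V) : R := Num.sqrt (complex.Re (ip x x)).

Definition hcomplete (R : realType) (V : lmodType R[i]) (ip : V -> V -> R[i])
  : Prop :=
  forall u : nat -> V,
    (forall e : R, 0 < e -> exists N : nat, forall m n : nat,
        (N <= m)%N -> (N <= n)%N -> hnorm ip (u m - u n) < e) ->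
    exists l : V, forall e : R, 0 < e -> exists N : nat, forall n : nat,
        (N <= n)%N -> hnorm ip (u n - l) < e.

Definition is_hilbert (R : realType) (V : lmodType R[i]) (ip : V -> V -> R[i])
  : Prop := is_inner_product ip /\ hcomplete ip.

Definition bounded_linear (R : realType) (V : lmodType R[i])
    (ip : V -> V -> R[i]) (L : V -> V) : Prop :=
  (forall (a : R[i]) (x y : V), L (a *: x + y) = a *: L x + L y) /\
  (exists K : R, forall x : V, hnorm ip (L x) <= K * hnorm ip x).

Definition vlim0r (R : realType) (V : lmodType R[i]) (ip : V -> V -> R[i])
    (f : R -> V) (l : V) : Prop :=
  forall e : R, 0 < e -> exists d : R, 0 < d /\
    forall t : R, 0 < t -> t < d -> hnorm ip (f t - l) < e.

Definition C0_semigroup (R : realType) (V : lmodType R[i])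
    (ip : V -> V -> R[i]) (T : R -> V -> V) : Prop :=
  [/\ forall t : R, 0 <= t -> bounded_linear ip (T t),
      forall x : V, T 0 x = x,
      forall (s t : R) (x : V), 0 <= s -> 0 <= t -> T (s + t) x = T s (T t x)
    & forall x : V, vlim0r ip (fun t => T t x) x].

Definition unif_bounded (R : realType) (V : lmodType R[i])
    (ip : V -> V -> R[i]) (T : R -> V -> V) : Prop :=
  exists M : R, forall (t : R) (x : V), 0 <= t -> hnorm ip (T t x) <= M * hnorm ip x.

Definition generator (R : realType) (V : lmodType R[i]) (ip : V -> V -> R[i])
    (T : R -> V -> V) (DA : set V) (A : V -> V) : Prop :=
  (forall x : V, DA x <->
     exists y : V, vlim0r ip (fun t => (real_complex R t^-1) *: (T t x - x)) y) /\
  (forall x : V, DA x ->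
     vlim0r ip (fun t => (real_complex R t^-1) *: (T t x - x)) (- A x)).

Definition cderivable (R : realType) (V : lmodType R[i]) (ip : V -> V -> R[i])
    (g : R[i] -> V) (z0 : R[i]) : Prop :=
  exists v : V, forall e : R, 0 < e -> exists d : R, 0 < d /\
    forall w : R[i], 0 < `|w| -> `|w| < real_complex R d ->
      hnorm ip (w^-1 *: (g (z0 + w) - g z0) - v) < e.

(* the open sector {z | |arg z| < delta} with delta = arctan c  (0 < delta < pi/2) *)
Definition in_sector (R : realType) (c : R) (z : R[i]) : Prop :=
  0 < complex.Re z /\ `|complex.Im z| < c * complex.Re z.

Definition holomorphic_sg (R : realType) (V : lmodType R[i])
    (ip : V -> V -> R[i]) (T : R -> V -> V) : Prop :=
  exists c : R, 0 < c /\ exists Tz : R[i] -> V -> V,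
    [/\ forall (t : R) (x : V), 0 < t -> Tz (real_complex R t) x = T t x,
        forall z : R[i], in_sector c z -> bounded_linear ip (Tz z)
      & forall (x : V) (z : R[i]), in_sector c z -> cderivable ip (fun w => Tz w x) z].

Definition num_range_lb (R : realType) (V : lmodType R[i]) (ip : V -> V -> R[i])
    (DA : set V) (A : V -> V) : \bar R :=
  ereal_inf [set (complex.Re (ip (A x) x))%:E | x in [set x | DA x /\ hnorm ip x = 1]].

Definition pos_accretive (R : realType) (V : lmodType R[i]) (ip : V -> V -> R[i])
    (DA : set V) (A : V -> V) : Prop :=
  forall x : V, DA x -> hnorm ip x = 1 -> 0 < complex.Re (ip (A x) x).

Definition cond_i (R : realType) (V : lmodType R[i]) (ip : V -> V -> R[i])
    (DA : set V) (A : V -> V) : Prop :=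
  forall x : V, DA x -> DA (A x) -> hnorm ip x = 1 ->
    2 * (complex.Re (ip (A x) x)) ^+ 2
      <= complex.Re (ip (A (A x)) x) + hnorm ip (A x) ^+ 2.

Definition cond_ii (R : realType) (V : lmodType R[i]) (ip : V -> V -> R[i])
    (T : R -> V -> V) : Prop :=
  forall u0 : V, u0 != 0 -> forall r s t : R, 0 <= r -> r < s -> s < t ->
    hnorm ip (T s u0) <=
      powR (hnorm ip (T r u0)) ((t - s) / (t - r)) *
      powR (hnorm ip (T t u0)) ((s - r) / (t - r)).

(* Main.v *)
(* Put [h t = |T t u|] and [f = h^2]. Holomorphy is used only to differentiate the orbit
   [T t u] in norm at [t > 0]; with the semigroup law this puts [T t u] in the
   domain of every power of [A], so that [f' = - 2 Re <A x, x>] and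
   [f'' = 2 (Re <A^2 x, x> + |A x|^2)] at [x = T t u]. Condition (i) at [x] thus
   says [f'^2 <= f f''], which is equivalent to the log-convexity of [f]: one
   direction goes through the convexity of all [exp (c t) f], which needs no
   nonvanishing of [f]; the other, for [u] in the domain of [A^2], lets [t] tend
   to 0. Log-convexity together with [h 0 <> 0] excludes zeros of [h]. Accretivity
   gives [f' < 0]; strict convexity is then the strict weighted AM-GM
   inequality, as [h] takes distinct values. The slopes [(h t - h 0) / t] are
   monotone and are values of [h'] by the mean value theorem. *)
Require Import Defs.
From mathcomp Require Import all_boot all_order all_algebra.
From mathcomp Require Import all_classical all_reals all_analysis.
From mathcomp.real_closed Require Import complex.
From mathcomp Require Import ring lra.
Import Order.TTheory GRing.Theory Num.Theory.
Import numFieldNormedType.Exports.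
Local Open Scope classical_set_scope.
Local Open Scope ring_scope.

(** * Real functions on the half-line: convexity, log-convexity, right slopes *)

Section RealAnalysis.
Context {R : realType}.
Set Implicit Arguments.
Unset Strict Implicit.
Implicit Types f g : R -> R.

(** With [m] the weighted mean of the logarithms, [a] and [b] are [expR m] times exponentials of
    deviations from [m]. The bound [expR x >= 1 + x], strict for nonzero [x], applies to these, and
    the weighted deviations cancel. *)
Lemma powR_mul_lt_conv (a b p q : R) : 0 < a -> 0 < b -> a != b ->
  0 < p -> 0 < q -> p + q = 1 -> a `^ p * b `^ q < p * a + q * b.
Proof.
move=> a0 b0 ab p0 q0 pq.
rewrite /powR !gt_eqF// -expRD; set m := p * ln a + q * ln b.
have E x : 0 < x -> x = expR m * expR (ln x - m).
  by move=> x0; rewrite -expRD subrKC lnK.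
have lnab : ln a != ln b by apply: contra ab => /eqP/ln_inj->//; rewrite posrE.
have am : ln a - m != 0.
  have -> : ln a - m = q * (ln a - ln b).
    by rewrite /m (_ : p = 1 - q); [ring|rewrite -pq addrK].
  by apply: mulf_neq0; rewrite ?subr_eq0// lt0r_neq0.
rewrite [in ltRHS](E a)// [in ltRHS](E b)// !(mulrCA _ (expR m)) -mulrDr.
rewrite ltr_pMr ?expR_gt0//.
have := expR_gt1Dx am; have := expR_ge1Dx (ln b - m).
move: (expR _) (expR _) => x y yb xa.
rewrite -(ltr_pM2l p0) in xa; rewrite -(ler_pM2l q0) in yb.
have {xa yb} xy := ltr_leD xa yb; apply: le_lt_trans xy.
rewrite le_eqVlt; apply/orP; left; apply/eqP.
have -> : p * (1 + (ln a - m)) + q * (1 + (ln b - m)) =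
   (p + q) + m - (p + q) * m by rewrite {3}/m; ring.
by rewrite pq; ring.
Qed.

(** Derivatives are available for [t > 0] only; right-continuity at 0 lets closed intervals start
    there. *)
Lemma derivable_oy_within_continuous f (a b : R) : (forall t : R, 0 < t -> derivable f t 1) ->
  f x @[x --> 0^'+] --> f 0 -> 0 <= a -> a < b -> {within `[a, b], continuous f}.
Proof.
move=> df f0 a0 ab.
have cf (t : R) : 0 < t -> {for t, continuous f}.
  by move=> t0; apply/differentiable_continuous/derivable1_diffP/df.
apply/continuous_within_itvP => //; split.
- by move=> x /[!in_itv]/= /andP[ax _]; apply: cf; exact: le_lt_trans ax.
- move: a0; rewrite le_eqVlt => /predU1P[<-//|a0].
  by apply: cvg_at_right_filter; exact: cf.
- by apply: cvg_at_left_filter; apply: cf; exact: le_lt_trans ab.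
Qed.

Lemma MVT_oy f (f1 : R -> R) (a b : R) : (forall t : R, 0 < t -> is_derive t 1 f (f1 t)) ->
  f x @[x --> 0^'+] --> f 0 -> 0 <= a -> a < b ->
  exists2 c, a < c < b & f b - f a = f1 c * (b - a).
Proof.
move=> df f0 a0 ab; have [|||c] := @MVT _ f f1 a b => //; last by rewrite in_itv; exists c.
- by move=> x /[!in_itv]/= /andP[ax _]; apply: df; exact: le_lt_trans ax.
- apply: derivable_oy_within_continuous => // t t0; exact: (@ex_derive _ _ _ _ _ _ _ (df t t0)).
Qed.

(** The mean value theorem on each side of [s] yields slopes [f1 c1] and [f1 c2] with [c1 < c2]; a
    third use of it, for [f1], orders them. *)
Lemma second_derive_ge0_convex f (f1 f2 : R -> R) :
  (forall t : R, 0 < t -> is_derive t 1 f (f1 t)) ->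
  (forall t : R, 0 < t -> is_derive t 1 f1 (f2 t)) ->
  f x @[x --> 0^'+] --> f 0 -> (forall t : R, 0 < t -> 0 <= f2 t) ->
  forall r s t : R, 0 <= r -> r < s -> s < t ->
    f s * (t - r) <= (t - s) * f r + (s - r) * f t.
Proof.
move=> df df1 f0 f2ge0 r s t r0 rs st.
have [c1 /andP[rc1 c1s] E1] := MVT_oy df f0 r0 rs.
have [c2 /andP[sc2 c2t] E2] := MVT_oy df f0 (ltW (le_lt_trans r0 rs)) st.
have c1p : 0 < c1 by exact: le_lt_trans rc1.
have c12 : c1 < c2 by exact: lt_trans sc2.
have f12 : f1 c1 <= f1 c2.
  have [|||c cin E] := @MVT _ f1 f2 c1 c2 => //.
  - by move=> x /[!in_itv]/= /andP[ax _]; apply: df1; exact: lt_trans ax.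
  - apply: derivable_within_continuous => x /[!in_itv]/= /andP[ax _].
    by apply: (@ex_derive _ _ _ _ _ _ _ (df1 x _)); exact: lt_le_trans ax.
  rewrite -subr_ge0 E mulr_ge0 ?subr_ge0 ?(ltW c12)// f2ge0//.
  by move: cin; rewrite in_itv/= => /andP[+ _]; exact: lt_trans.
(* This product is exactly the convexity gap. *)
have : 0 <= (s - r) * (t - s) * (f1 c2 - f1 c1).
  by rewrite !mulr_ge0 ?subr_ge0// ltW.
have -> : f s = f r + f1 c1 * (s - r) by rewrite -E1 subrKC.
have -> : f t = f r + f1 c1 * (s - r) + f1 c2 * (t - s) by rewrite -E1 -E2; ring.
lra.
Qed.

(** Stands in for letting [q] tend to 0. Dividing by [k + 1] covers the case [k = 0]. *)
Lemma le0_of_le_mul_gt0 (p k : R) : 0 <= k -> (forall q, 0 < q -> p <= k * q) -> p <= 0.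
Proof.
move=> k0 pk; rewrite leNgt; apply/negP => p0.
have k1 : 0 < k + 1 by rewrite ltr_wpDl.
have := pk (p / (k + 1)) (divr_gt0 p0 k1).
by rewrite mulrA ler_pdivlMr// mulrDr mulr1 mulrC gerDl leNgt p0.
Qed.

(* Choosing [c] so that [expR (c * x) * f x] takes equal values at [r] and [t]
   gives the bound; if [f] vanishes at an endpoint, let [c] tend to infinity. *)
Lemma log_convex_of_exp_convex f : (forall t : R, 0 <= t -> 0 <= f t) ->
  (forall c r s t : R, 0 <= r -> r < s -> s < t ->
    expR (c * s) * f s * (t - r) <=
      (t - s) * (expR (c * r) * f r) + (s - r) * (expR (c * t) * f t)) ->
  forall r s t : R, 0 <= r -> r < s -> s < t ->
    f s <= f r `^ ((t - s) / (t - r)) * f t `^ ((s - r) / (t - r)).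
Proof.
move=> f0 cvx r s t r0 rs st.
have tr : 0 < t - r by rewrite subr_gt0 (lt_trans rs).
have ts : 0 < t - s by rewrite subr_gt0.
have sr : 0 < s - r by rewrite subr_gt0.
have s0 : 0 <= s by rewrite (le_trans r0)// ltW.
have t0 : 0 <= t by rewrite (le_trans s0)// ltW.
(* Dividing by [expR (c * s)] leaves only offsets from [s] in the exponents. *)
have shift c : f s * (t - r) <= (t - s) * (expR (c * (r - s)) * f r) +
    (s - r) * (expR (c * (t - s)) * f t).
  rewrite -(ler_pM2l (expR_gt0 (c * s))).
  have := cvx c r s t r0 rs st; rewrite -mulrA => /le_trans; apply.
  have -> : c * r = c * s + c * (r - s) by ring.
  have -> : c * t = c * s + c * (t - s) by ring.
  by rewrite !expRD le_eqVlt; apply/orP; left; apply/eqP; ring.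
have [fr0|fr0] := eqVneq (f r) 0.
  rewrite fr0 powR0 ?mulf_neq0 ?invr_neq0 ?gt_eqF// mul0r.
  rewrite -(pmulr_lle0 _ tr); apply: (@le0_of_le_mul_gt0 _ ((s - r) * f t)).
    by rewrite mulr_ge0 ?f0// ltW.
  (* This [c] makes the exponential weight at [t] equal to the arbitrary [q]. *)
  move=> q q0; have := shift (ln q / (t - s)).
  by rewrite fr0 !mulr0 add0r divfK ?gt_eqF// lnK// mulrA mulrAC.
have [ft0|ft0] := eqVneq (f t) 0.
  rewrite ft0 powR0 ?mulf_neq0 ?invr_neq0 ?gt_eqF// mulr0.
  rewrite -(pmulr_lle0 _ tr); apply: (@le0_of_le_mul_gt0 _ ((t - s) * f r)).
    by rewrite mulr_ge0 ?f0// ltW.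
  move=> q q0; have := shift (ln q / (r - s)).
  rewrite ft0 !mulr0 addr0 divfK ?lt_eqF ?subr_lt0// lnK//.
  by rewrite mulrA mulrAC.
have frp : 0 < f r by rewrite lt_def fr0 f0.
have ftp : 0 < f t by rewrite lt_def ft0 f0.
rewrite /powR (negbTE fr0) (negbTE ft0) -expRD -(ler_pM2r tr).
(* With this [c] both exponents become the logarithm of the product of powers. *)
apply: (le_trans (shift ((ln (f r) - ln (f t)) / (t - r)))).
rewrite -{2}(lnK frp) -{3}(lnK ftp) -!expRD.
set l := ln (f r); set m := ln (f t).
have tr0 := gt_eqF tr.
have -> : (l - m) / (t - r) * (r - s) + l = (t - s) / (t - r) * l + (s - r) / (t - r) * m.
  by field; rewrite tr0.
have -> : (l - m) / (t - r) * (t - s) + m = (t - s) / (t - r) * l + (s - r) / (t - r) * m.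
  by field; rewrite tr0.
by rewrite -mulrDl mulrC le_eqVlt; apply/orP; left; apply/eqP; ring.
Qed.

(** The second derivative of [expR (c * x) * f x] is [expR (c * x)] times a quadratic in [c] with
    coefficients [f], [2 * f1], [f2]. The last hypothesis says that its discriminant is nonpositive,
    so every such function is convex. *)
Lemma log_convex_of_second_derivative f (f1 f2 : R -> R) :
  (forall t : R, 0 < t -> is_derive t 1 f (f1 t)) ->
  (forall t : R, 0 < t -> is_derive t 1 f1 (f2 t)) ->
  f x @[x --> 0^'+] --> f 0 ->
  (forall t : R, 0 <= t -> 0 <= f t) -> (forall t : R, 0 < t -> 0 <= f2 t) ->
  (forall t : R, 0 < t -> f1 t ^+ 2 <= f t * f2 t) ->
  forall r s t : R, 0 <= r -> r < s -> s < t ->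
    f s <= f r `^ ((t - s) / (t - r)) * f t `^ ((s - r) / (t - r)).
Proof.
move=> df df1 f0 fge0 f2ge0 disc; apply: log_convex_of_exp_convex => // c.
have de (t : R) : is_derive t 1 (fun x => expR (c * x)) (c * expR (c * t)).
  have dc : is_derive t 1 (fun x : R => c * x) c.
    by rewrite -[X in is_derive _ _ _ X]mulr1; exact: is_deriveZ.
  by rewrite mulrC; apply: (is_derive1_comp (f := expR)).
apply: (@second_derive_ge0_convex (fun x => expR (c * x) * f x)
  (fun x => expR (c * x) * (f1 x + c * f x))
  (fun x => expR (c * x) * (f2 x + 2 * c * f1 x + c ^+ 2 * f x))).
- move=> t t0; have dft := df t t0; have det := de t.
  apply: (is_derive_eq (is_deriveM det dft)); rewrite /GRing.scale/=; ring.
- move=> t t0; have dft := df t t0; have dft1 := df1 t t0; have det := de t.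
  have dcf : is_derive t 1 (fun x => c * f x) (c * f1 t) by exact: is_deriveZ.
  have d1 : is_derive t 1 (fun x => f1 x + c * f x) (f2 t + c * f1 t).
    exact: is_deriveD.
  apply: (is_derive_eq (is_deriveM det d1)); rewrite /GRing.scale/=; ring.
- apply: cvgM => //; apply: cvg_at_right_filter.
  have de0 : derivable (fun x => expR (c * x)) 0 1 := @ex_derive _ _ _ _ _ _ _ (de 0).
  by move/derivable1_diffP/differentiable_continuous : de0.
- move=> t t0; rewrite mulr_ge0 ?expR_ge0//.
  (* Where [f] vanishes, [f1] vanishes too, and the quadratic reduces to [f2 t]. *)
  have [ft0|ft0] := eqVneq (f t) 0.
    have := disc t t0; rewrite ft0 mul0r => d0.
    have /eqP -> : f1 t == 0 by rewrite -sqrf_eq0 eq_le d0 sqr_ge0.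
    by rewrite !mulr0 !addr0 f2ge0.
  have ftp : 0 < f t by rewrite lt_def ft0 fge0// ltW.
  rewrite -(pmulr_rge0 _ ftp).
  have -> : f t * (f2 t + 2 * c * f1 t + c ^+ 2 * f t) =
    (f1 t + c * f t) ^+ 2 + (f t * f2 t - f1 t ^+ 2) by ring.
  by rewrite addr_ge0 ?sqr_ge0 ?subr_ge0 ?disc.
Qed.

(* For fixed [t], the function [f (t - x) * f (t + x)] of [x] has a minimum at
   [x = 0], so its second derivative there is nonnegative. *)
Lemma log_convex_second_derivative f (f1 f2 : R -> R) :
  (forall t : R, 0 < t -> is_derive t 1 f (f1 t)) ->
  (forall t : R, 0 < t -> is_derive t 1 f1 (f2 t)) ->
  (forall t x : R, 0 <= x -> x < t -> f t ^+ 2 <= f (t - x) * f (t + x)) ->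
  forall t : R, 0 < t -> f1 t ^+ 2 <= f t * f2 t.
Proof.
move=> df df1 mid t t0; rewrite leNgt; apply/negP => neg.
pose g x := f (t - x) * f (t + x).
pose g1 x := f (t - x) * f1 (t + x) - f1 (t - x) * f (t + x).
have dl (k k1 : R -> R) (x : R) : (forall y : R, 0 < y -> is_derive y 1 k (k1 y)) ->
    x < t -> is_derive x 1 (fun x => k (t - x)) (- k1 (t - x)).
  move=> dk xt; rewrite -mulrN1; apply: (is_derive1_comp (f := k)).
    by apply: dk; rewrite subr_gt0.
  by rewrite -sub0r; apply: is_deriveB.
have dr (k k1 : R -> R) (x : R) : (forall y : R, 0 < y -> is_derive y 1 k (k1 y)) ->
    - t < x -> is_derive x 1 (fun x => k (t + x)) (k1 (t + x)).
  move=> dk xt; rewrite -[k1 _]mulr1; apply: (is_derive1_comp (f := k)).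
    by apply: dk; rewrite -ltrBlDl sub0r.
  by rewrite -[X in is_derive _ _ _ X]add0r; apply: is_deriveD.
have dg (x : R) : - t < x -> x < t -> is_derive x 1 g (g1 x).
  move=> tx xt; have d1 := dl _ _ x df xt; have d2 := dr _ _ x df tx.
  by apply: (is_derive_eq (is_deriveM d1 d2)); rewrite /GRing.scale/= /g1; ring.
(* This second derivative of [g] at 0 is negative by [neg]. *)
have dg1 : is_derive (0 : R) 1 g1 (2 * (f t * f2 t - f1 t ^+ 2)).
  have tN : - t < 0 by rewrite oppr_lt0.
  have d1 := dl _ _ 0 df t0; have d2 := dr _ _ 0 df tN.
  have d3 := dl _ _ 0 df1 t0; have d4 := dr _ _ 0 df1 tN.
  apply: (is_derive_eq (is_deriveB (is_deriveM d1 d4) (is_deriveM d3 d2))).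
  by rewrite /GRing.scale/= subr0 addr0; ring.
have g10 : g1 0 = 0 by rewrite /g1 subr0 addr0 mulrC subrr.
(* As [g1 0 = 0], this is the difference quotient of [g1] at 0; so [g1] is negative just to the
   right of 0. *)
have : \forall x \near (0 : R)^'+, x^-1 * g1 x < 0.
  have : x^-1 * g1 x @[x --> (0 : R)^'+] --> 2 * (f t * f2 t - f1 t ^+ 2).
    have [dg1d dg1E] := dg1; rewrite -dg1E; apply: cvg_dnbhs_at_right.
    apply: cvg_trans dg1d; apply: near_eq_cvg; apply: nearW => x /=.
    by rewrite g10 subr0 [_%:A]mulr1 addr0.
  by move/cvgr_lt; apply; rewrite pmulr_rlt0// subr_lt0.
rewrite near_withinE => -[d /= d0 dP].
(* Below [d] the sign of [g1] is known; below [t] the arguments of [f] stay positive. The mean value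
   theorem then gives [g e < g 0], against [mid]. *)
pose e := Num.min d t / 2.
have m0 : 0 < Num.min d t by rewrite lt_min d0.
have e0 : 0 < e by rewrite divr_gt0.
have em : e < Num.min d t by rewrite ltr_pdivrMr// ltr_pMr// ltr1n.
have /andP[ed et] : (e < d) && (e < t) by rewrite -lt_min.
have Ntx (x : R) : 0 <= x -> - t < x by move=> x0; rewrite (lt_le_trans _ x0)// oppr_lt0.
have [|||c /[!in_itv]/= /andP[c0 ce] E] := @MVT _ g g1 0 e => //.
- move=> x /[!in_itv]/= /andP[x0 xe]; apply: dg; first exact/Ntx/ltW.
  exact: lt_trans et.
- apply: derivable_within_continuous => x /[!in_itv]/= /andP[x0 xe].
  apply: (@ex_derive _ _ _ _ _ _ _ (dg x _ _)); first exact: Ntx.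
  exact: le_lt_trans et.
have := mid t e (ltW e0) et; rewrite -/(g e) leNgt => /negP; apply.
have -> : f t ^+ 2 = g 0 by rewrite /g subr0 addr0 expr2.
rewrite -subr_lt0 E subr0 pmulr_llt0//.
have : c^-1 * g1 c < 0.
  by apply: dP => //=; rewrite sub0r normrN gtr0_norm// (lt_trans ce).
by rewrite pmulr_rlt0// invr_gt0.
Qed.

(** By induction each iterated derivative agrees with a member of [F] on the open half-line, hence
    near each of its points. *)
Lemma derivable_derive1n_family (F : (R -> R) -> Prop) :
  (forall g, F g -> exists2 g1, F g1 & forall t : R, 0 < t -> is_derive t 1 g (g1 t)) ->
  forall g, F g -> forall n (t : R), 0 < t -> derivable (derive1n n g) t 1.
Proof.
move=> dF g Fg n t t0.
have [k Fk gk] : exists2 k, F k & forall s : R, 0 < s -> derive1n n g s = k s.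
  elim: n => [|n [k Fk IH]]; first by exists g.
  have [k1 Fk1 dk] := dF _ Fk; exists k1 => // s s0.
  rewrite derive1nS derive1E (near_eq_derive (g := k)).
    by have := dk s s0 => dks; rewrite derive_val.
  by near=> y; apply: IH; near: y; exact: lt_nbhsr.
have [k1 _ dk] := dF _ Fk; apply: (near_eq_derivable (f := k)).
  by near=> y; rewrite gk//; near: y; exact: lt_nbhsr.
by apply: (@ex_derive _ _ _ _ _ _ _ (dk t t0)).
Unshelve. all: by end_near. Qed.

(** Convexity makes the slopes from 0 nondecreasing, so they converge to their infimum, possibly
    [-oo]. Each slope is a value of the derivative by the mean value theorem, and the derivative at
    [t] is at least the slope from 0 to [t], so both infima agree. *)
Lemma convex_right_slope_cvg f :
  (forall t : R, 0 < t -> derivable f t 1) -> f x @[x --> 0^'+] --> f 0 ->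
  (forall r s t : R, 0 <= r -> r < s -> s < t ->
    f s * (t - r) <= (t - s) * f r + (s - r) * f t) ->
  ((f t - f 0) / t)%:E @[t --> 0^'+] -->
    ereal_inf [set (derive1 f t)%:E | t in `]0, +oo[%classic].
Proof.
move=> df f0 cvx; pose q t : \bar R := ((f t - f 0) / t)%:E.
have slope_le (t x : R) : 0 < t -> 0 < x -> (f t - f 0) / t <= (f (x + t) - f t) / x.
  move=> t0 x0; rewrite ler_pdivrMr// mulrAC ler_pdivlMr//.
  by have := cvx 0 t (x + t) (lexx _) t0; rewrite ltrDr => /(_ x0); lra.
have qd : {in `]0, +oo[ &, {homo q : s t / s <= t >-> (s <= t)%E}}.
  move=> s t /[!in_itv]/=; rewrite !andbT => s0 t0; rewrite le_eqVlt => /predU1P[->//|st].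
  rewrite lee_fin ler_pdivrMr// mulrAC ler_pdivlMr//.
  by have := cvx 0 s t (lexx _) s0 st; lra.
have -> : ereal_inf [set (derive1 f t)%:E | t in `]0, +oo[%classic] =
    ereal_inf (q @` [set` `]0, +oo[]).
  apply/le_anti/andP; split.
    apply: le_ereal_inf_tmp => _ /= [t + <-]; rewrite in_itv/= andbT => t0.
    have dfE (s : R) : 0 < s -> is_derive s 1 f (derive1 f s).
      by move=> s0; rewrite derive1E; apply/derivableP/df.
    have [c /andP[c0 ct] E] := MVT_oy dfE f0 (lexx 0) t0.
    apply: ereal_inf_lbound; exists c; first by rewrite /= in_itv/= c0.
    by rewrite /q E subr0 mulfK ?gt_eqF.
  apply: le_ereal_inf_tmp => _ /= [t + <-]; rewrite in_itv/= andbT => t0.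
  apply: (@le_trans _ _ (q t)); first by apply: ereal_inf_lbound; exists t; rewrite /= ?in_itv/= ?t0.
  rewrite lee_fin derive1E.
  have : x^-1 * (f (x + t) - f t) @[x --> (0 : R)^'+] --> 'D_1 f t.
    apply: cvg_dnbhs_at_right; apply: cvg_trans (df t t0).
    by apply: near_eq_cvg; apply: nearW => x /=; rewrite [_%:A]mulr1.
  move/cvgr_to_ge; apply; near=> x; rewrite [leRHS]mulrC slope_le//.
exact: nondecreasing_at_right_cvge.
Unshelve. all: by end_near. Qed.
End RealAnalysis.

(** * The real part of the inner product and the norm *)

Section RealInnerProduct.
Set Implicit Arguments.
Unset Strict Implicit.
Context {R : realType} {V : lmodType R[i]} {ip : V -> V -> R[i]}.
Context (ipP : is_inner_product ip).

(** A symmetric real bilinear form with the same norm as [ip], so that derivatives of squared norms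
    stay real. *)
Definition rip (x y : V) : R := complex.Re (ip x y).

Local Notation "c '%:r*:' x" := (real_complex R c *: x) (at level 40).

Lemma ripDl x y z : rip (x + y) z = rip x z + rip y z.
Proof.
case: ipP => lin _ _ _; rewrite /rip -{1}(scale1r x) lin mul1r.
by case: (ip x z) (ip y z) => [a b] [c d].
Qed.

Lemma ripC x y : rip x y = rip y x.
Proof. by case: ipP => _ cj _ _; rewrite /rip (cj y x); case: (ip y x). Qed.

Lemma ip0l z : ip 0 z = 0.
Proof.
case: ipP => lin _ _ _; have := lin 1 0 0 z.
rewrite scaler0 addr0 mul1r => /eqP.
by rewrite -subr_eq0 opprD addrA subrr add0r oppr_eq0 => /eqP.
Qed.

Lemma ripZl (a : R) x z : rip (a %:r*: x) z = a * rip x z.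
Proof.
case: ipP => lin _ _ _; rewrite /rip -(addr0 (_ *: x)) lin ip0l addr0.
by case: (ip x z) => b c /=; rewrite mul0r subr0.
Qed.

Lemma ripDr x y z : rip z (x + y) = rip z x + rip z y.
Proof. by rewrite !(ripC z) ripDl. Qed.

Lemma ripZr (a : R) x z : rip z (a %:r*: x) = a * rip z x.
Proof. by rewrite !(ripC z) ripZl. Qed.

Lemma ripNl x z : rip (- x) z = - rip x z.
Proof. by rewrite -[- x]scaleN1r -(rmorphN1 (real_complex R)) ripZl mulN1r. Qed.

Lemma ripNr x z : rip z (- x) = - rip z x.
Proof. by rewrite !(ripC z) ripNl. Qed.

Lemma ripBl x y z : rip (x - y) z = rip x z - rip y z.
Proof. by rewrite ripDl ripNl. Qed.

Lemma ripBr x y z : rip z (x - y) = rip z x - rip z y.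
Proof. by rewrite ripDr ripNr. Qed.

Lemma rip_ge0 x : 0 <= rip x x.
Proof. by case: ipP => _ _ /(_ x); rewrite lecE => /andP[]. Qed.

Lemma hnorm_ge0 x : 0 <= hnorm ip x.
Proof. exact: sqrtr_ge0. Qed.

Lemma hnorm_sqr x : hnorm ip x ^+ 2 = rip x x.
Proof. by rewrite sqr_sqrtr// rip_ge0. Qed.

Lemma hnorm0 : hnorm ip 0 = 0.
Proof. by rewrite /hnorm ip0l sqrtr0. Qed.

Lemma hnorm_eq0 x : hnorm ip x = 0 -> x = 0.
Proof.
(* In the order of [R[i]], [0 <= ip x x] already forces a zero imaginary part. *)
move=> x0; case: ipP => _ _ pos; apply; have := pos x; rewrite lecE => /andP[].
have : rip x x = 0 by rewrite -hnorm_sqr x0 expr0n.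
by rewrite /rip; case: (ip x x) => a b /= -> /eqP ->.
Qed.

Lemma hnorm_gt0 x : x != 0 -> 0 < hnorm ip x.
Proof.
by move=> x0; rewrite lt_def hnorm_ge0 andbT; apply: contra x0 => /eqP/hnorm_eq0->.
Qed.

Lemma hnormZ (a : R) x : hnorm ip (a %:r*: x) = `|a| * hnorm ip x.
Proof.
apply/eqP; rewrite -(@eqrXn2 _ 2)// ?hnorm_ge0 ?mulr_ge0 ?hnorm_ge0//.
by rewrite exprMn !hnorm_sqr ripZl ripZr mulrA -expr2 real_normK// num_real.
Qed.

Lemma hnormN x : hnorm ip (- x) = hnorm ip x.
Proof.
by rewrite -[- x]scaleN1r -(rmorphN1 (real_complex R)) hnormZ normrN1 mul1r.
Qed.

Lemma hnormB x y : hnorm ip (x - y) = hnorm ip (y - x).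
Proof. by rewrite -hnormN opprB. Qed.

Lemma cauchy_schwarz x y : `|rip x y| <= hnorm ip x * hnorm ip y.
Proof.
rewrite -(@ler_pXn2r _ 2)// ?nnegrE ?mulr_ge0 ?hnorm_ge0//.
rewrite exprMn real_normK ?num_real// !hnorm_sqr.
have [y0|y0] := eqVneq (rip y y) 0.
  have -> : y = 0 by apply: hnorm_eq0; rewrite /hnorm -/(rip y y) y0 sqrtr0.
  by rewrite -(scaler0 _ 0) -[0 *: _]/(0 %:r*: (0 : V)) !ripZr !mul0r expr0n mulr0.
have yp : 0 < rip y y by rewrite lt_def y0 rip_ge0.
(* This vector is [rip y y] times the component of [x] orthogonal to [y]; the scaling avoids a
   division. *)
have := rip_ge0 (rip y y %:r*: x - rip x y %:r*: y).
rewrite !(ripBl, ripBr, ripZl, ripZr) (ripC y x).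
have -> : rip y y * (rip y y * rip x x - rip x y * rip x y) -
   rip x y * (rip y y * rip x y - rip x y * rip y y) =
   rip y y * (rip x x * rip y y - rip x y ^+ 2) by ring.
by rewrite pmulr_rge0// subr_ge0.
Qed.

Lemma hnormD x y : hnorm ip (x + y) <= hnorm ip x + hnorm ip y.
Proof.
rewrite -(@ler_pXn2r _ 2)// ?nnegrE ?addr_ge0 ?hnorm_ge0//.
rewrite sqrrD !hnorm_sqr !(ripDl, ripDr) (ripC y x).
have := le_trans (ler_norm _) (cauchy_schwarz x y); lra.
Qed.

(** * Norm convergence, encoded as real convergence of distances, and norm derivatives *)

Definition vcvg {T : Type} (F : set_system T) (f : T -> V) (l : V) : Prop :=
  hnorm ip (f x - l) @[x --> F] --> (0 : R).

Lemma vcvgP {T : Type} (F : set_system T) {FF : Filter F} (f : T -> V) (l : V) :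
  vcvg F f l <-> forall e : R, 0 < e -> \forall x \near F, hnorm ip (f x - l) < e.
Proof.
split=> [/cvgrPdist_lt fl e /fl|fl]; last apply/cvgrPdist_lt => e /fl;
  by apply: filterS => x; rewrite sub0r normrN ger0_norm// hnorm_ge0.
Qed.

Lemma vlim0rP (f : R -> V) l : vlim0r ip f l <-> vcvg 0^'+ f l.
Proof.
split=> [fl|/vcvgP fl e /fl].
  apply/vcvgP => e /fl[d [d0 dP]]; near=> t; apply: dP; near: t.
    exact: nbhs_right_gt.
  exact: nbhs_right_lt.
rewrite near_withinE => -[d /= d0 dP]; exists d; split=> // t t0 td.
by apply: dP => //=; rewrite sub0r normrN gtr0_norm.
Unshelve. all: by end_near. Qed.

Lemma vcvg_le {T : Type} (F : set_system T) {FF : Filter F} (f : T -> V) l (u : T -> R) :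
  (\forall x \near F, hnorm ip (f x - l) <= u x) -> u x @[x --> F] --> 0 ->
  vcvg F f l.
Proof.
move=> fu u0; apply: (@squeeze_cvgr _ _ _ _ (cst 0) u) => //; last exact: cvg_cst.
by apply: filterS fu => x ->; rewrite hnorm_ge0.
Qed.

Lemma vcvg_unique {T : Type} (F : set_system T) {FF : ProperFilter F} (f : T -> V) l l' :
  vcvg F f l -> vcvg F f l' -> l = l'.
Proof.
move=> fl fl'; apply/eqP; rewrite -subr_eq0; apply/eqP/hnorm_eq0.
apply/le_anti; rewrite hnorm_ge0 andbT.
have : hnorm ip (f x - l) + hnorm ip (f x - l') @[x --> F] --> (0 : R).
  by rewrite -[X in _ --> X]addr0; exact: cvgD.
move=> /(cvgr_to_ge); apply; apply: nearW => x.
by rewrite (hnormB _ l) (le_trans _ (hnormD _ _))// addrA subrK.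
Qed.

Lemma vcvg_near {T : Type} (F : set_system T) {FF : Filter F} (f g : T -> V) l :
  (\forall x \near F, f x = g x) -> vcvg F f l -> vcvg F g l.
Proof.
move=> fg; apply: cvg_trans; apply: near_eq_cvg.
by apply: filterS fg => x ->.
Qed.

Lemma vcvg_cst {T : Type} (F : set_system T) {FF : Filter F} l : vcvg F (cst l) l.
Proof.
apply: (vcvg_le (u := cst 0)); last exact: cvg_cst.
by apply: nearW => x; rewrite subrr hnorm0.
Qed.

Lemma vcvgD {T : Type} (F : set_system T) {FF : Filter F} (f g : T -> V) l m :
  vcvg F f l -> vcvg F g m -> vcvg F (fun x => f x + g x) (l + m).
Proof.
move=> fl gm; apply: (vcvg_le (u := fun x => hnorm ip (f x - l) + hnorm ip (g x - m))).
  by apply: nearW => x; rewrite opprD addrACA hnormD.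
by rewrite -[X in _ --> X]addr0; exact: cvgD.
Qed.

Lemma vcvgZ {T : Type} (F : set_system T) {FF : Filter F} (a : T -> R) b (f : T -> V) l :
  a x @[x --> F] --> b -> vcvg F f l -> vcvg F (fun x => a x %:r*: f x) (b %:r*: l).
Proof.
move=> ab fl.
apply: (vcvg_le (u := fun x => `|a x| * hnorm ip (f x - l) + `|a x - b| * hnorm ip l)).
  apply: nearW => x; rewrite -!hnormZ (le_trans _ (hnormD _ _))//.
  by rewrite rmorphB/= scalerBr scalerBl addrA subrK.
rewrite -[X in _ --> X]addr0; apply: cvgD.
  by rewrite -(mulr0 `|b|); apply: cvgM => //; exact: cvg_norm.
rewrite -[X in _ --> X](mul0r (hnorm ip l)); apply: cvgMl.
by rewrite -(normr0 R) -(subrr b); apply: cvg_norm; apply: cvgB => //; exact: cvg_cst.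
Qed.

Lemma cvg_rip {T : Type} (F : set_system T) {FF : Filter F} (f g : T -> V) l m :
  vcvg F f l -> vcvg F g m -> rip (f x) (g x) @[x --> F] --> rip l m.
Proof.
move=> fl gm.
(* One term for the product of the two errors and one for each error against the other limit: the
   bound tends to 0 without estimating [f] or [g]. *)
pose u x := hnorm ip (f x - l) * hnorm ip (g x - m) + hnorm ip (f x - l) * hnorm ip m +
  hnorm ip l * hnorm ip (g x - m).
have u0 : u x @[x --> F] --> 0.
  rewrite -[X in _ --> X](_ : 0 * 0 + 0 * hnorm ip m + hnorm ip l * 0 = 0); last by ring.
  by do 2?apply: cvgD; [exact: cvgM|exact: cvgMl|exact: cvgMr].
have fgu x : `|rip (f x) (g x) - rip l m| <= u x.
  have -> : rip (f x) (g x) - rip l m =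
      rip (f x - l) (g x - m) + rip (f x - l) m + rip l (g x - m).
    by rewrite !(ripBl, ripBr); ring.
  rewrite (le_trans (ler_normD _ _))// lerD ?cauchy_schwarz//.
  by rewrite (le_trans (ler_normD _ _))// lerD ?cauchy_schwarz.
apply/cvgrPdistC_le => e e0; move/cvgrPdistC_le : u0 => /(_ e e0).
apply: filterS => x; rewrite subr0 => xe; apply: le_trans xe.
by apply: (le_trans (fgu x)); exact: ler_norm.
Qed.

Lemma cvg_hnorm {T : Type} (F : set_system T) {FF : Filter F} (f : T -> V) l :
  vcvg F f l -> hnorm ip (f x) @[x --> F] --> hnorm ip l.
Proof.
move=> fl; apply: (@cvg_comp _ _ _ (fun x => rip (f x) (f x)) Num.sqrt).
  exact: (cvg_rip fl fl).
exact: sqrt_continuous.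
Qed.

(** The increment stands on the left in [s + t], so that the semigroup law splits off [T s]. *)
Definition vderiv (f : R -> V) (t : R) (l : V) : Prop :=
  vcvg (0 : R)^' (fun s : R => s^-1 %:r*: (f (s + t) - f t)) l.

Lemma vderiv_cvg f t l : vderiv f t l -> vcvg (0 : R)^' (fun s : R => f (s + t)) (f t).
Proof.
move=> fl; have id0 : (fun s : R => s) @ (0 : R)^' --> (0 : R) by exact: cvg_within.
have fs : vcvg (0 : R)^' (fun s : R => s %:r*: (s^-1 %:r*: (f (s + t) - f t)) + f t)
    (0 %:r*: l + f t).
  by apply: vcvgD; [exact: vcvgZ|exact: vcvg_cst].
rewrite -[0 %:r*: l]/(0 *: l) scale0r add0r in fs; apply: vcvg_near fs.
apply: filterS (nbhs_dnbhs_neq (0 : R)) => s s0.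
by rewrite /= scalerA -rmorphM/= divff// scale1r subrK.
Qed.

(** The quotient splits into one quotient of [f] against [g (s + t)] and one of [g] against [f t];
    continuity of [g] at [t] handles the first. *)
Lemma is_derive_rip f g t l m : vderiv f t l -> vderiv g t m ->
  is_derive t 1 (fun s => rip (f s) (g s)) (rip l (g t) + rip (f t) m).
Proof.
move=> fl gm.
have fg : rip (s^-1 %:r*: (f (s + t) - f t)) (g (s + t)) +
    rip (f t) (s^-1 %:r*: (g (s + t) - g t)) @[s --> (0 : R)^'] -->
    rip l (g t) + rip (f t) m.
  by apply: cvgD; apply: cvg_rip => //; [exact: vderiv_cvg gm|exact: vcvg_cst].
have {}fg : (fun s : R => s^-1 *: (((fun s => rip (f s) (g s)) \o shift t) (s *: (1 : R)) -
    rip (f t) (g t))) @ 0^' --> rip l (g t) + rip (f t) m.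
  apply: cvg_trans fg; apply: near_eq_cvg; apply: nearW => s /=.
  rewrite [_%:A]mulr1 ripZl ripZr !(ripBl, ripBr) /GRing.scale/=; ring.
by apply: DeriveDef; [exact: (cvgP _ fg)|exact: (cvg_lim _ fg)].
Qed.

(** * The semigroup, its generator and the smoothness of orbits *)

Section Semigroup.
Context {T : R -> V -> V} {DA : set V} {A : V -> V}.
Context (TC0 : C0_semigroup ip T) (Thol : holomorphic_sg ip T)
  (AT : generator ip T DA A).

Lemma semigroup0 t : 0 <= t -> T t 0 = 0.
Proof.
move=> t0; case: TC0 => /(_ t t0)[lin _] _ _ _; have := lin 1 0 0.
by rewrite !scale1r addr0 => /eqP; rewrite -subr_eq0 opprD addrA subrr add0r oppr_eq0 => /eqP.
Qed.

Lemma semigroupZ t a x : 0 <= t -> T t (a *: x) = a *: T t x.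
Proof.
move=> t0; have T0 := semigroup0 t0; case: TC0 => /(_ t t0)[lin _] _ _ _.
by have := lin a x 0; rewrite T0 !addr0.
Qed.

Lemma semigroupB t x y : 0 <= t -> T t (x - y) = T t x - T t y.
Proof.
move=> t0; case: TC0 => /(_ t t0)[lin _] _ _ _; rewrite addrC -scaleN1r lin scaleN1r.
by rewrite addrC.
Qed.

Lemma semigroupD s t x : 0 <= s -> 0 <= t -> T (s + t) x = T s (T t x).
Proof. by move=> s0 t0; case: TC0 => _ _ TD _; exact: TD. Qed.

Lemma vcvg_semigroup {U : Type} (F : set_system U) {FF : Filter F} (f : U -> V) l t :
  0 <= t -> vcvg F f l -> vcvg F (fun x => T t (f x)) (T t l).
Proof.
move=> t0 fl; case: TC0 => /(_ t t0)[_ [K TK]] _ _ _.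
apply: (vcvg_le (u := fun x => K * hnorm ip (f x - l))).
  by apply: nearW => x; rewrite -semigroupB.
by rewrite -(mulr0 K); exact: cvgMr.
Qed.

Lemma semigroup_cvg0 x : vcvg (0 : R)^'+ (T^~ x) x.
Proof. by case: TC0 => _ _ _ /(_ x)/vlim0rP. Qed.

Lemma generator_cvg x : DA x ->
  vcvg (0 : R)^'+ (fun t : R => t^-1 %:r*: (T t x - x)) (- A x).
Proof. by case: AT => _ /[apply] /vlim0rP. Qed.

(** Uniqueness of limits turns one computed limit into both membership in the domain and the value
    of [A]; the sign is there because the generator is [- A]. *)
Lemma generatorI x y : vcvg (0 : R)^'+ (fun t : R => t^-1 %:r*: (T t x - x)) (- y) ->
  DA x /\ A x = y.
Proof.
move=> xy; have Dx : DA x by case: AT => -> _; exists (- y); apply/vlim0rP.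
by split => //; apply: oppr_inj; exact: vcvg_unique (generator_cvg Dx) xy.
Qed.

Lemma generatorZ (a : R) x : DA x -> DA (a %:r*: x) /\ A (a %:r*: x) = a %:r*: A x.
Proof.
move=> Dx; apply: generatorI.
have h : vcvg (0 : R)^'+ (fun t : R => a %:r*: (t^-1 %:r*: (T t x - x))) (a %:r*: - A x).
  by apply: vcvgZ; [exact: cvg_cst|exact: generator_cvg].
rewrite scalerN in h.
apply: vcvg_near h; near=> t.
have t0 : 0 <= t by apply: ltW; near: t; exact: nbhs_right_gt.
by rewrite semigroupZ// -scalerBr scalerA mulrC -scalerA.
Unshelve. all: by end_near. Qed.

(** The bounded operator [T t] passes through the limit and commutes with every [T s]. *)
Lemma generator_semigroup t x : 0 <= t -> DA x -> DA (T t x) /\ A (T t x) = T t (A x).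
Proof.
move=> t0 Dx; apply: generatorI.
have h : vcvg (0 : R)^'+ (fun s : R => T t (s^-1 %:r*: (T s x - x))) (T t (- A x)).
  by apply: vcvg_semigroup => //; exact: generator_cvg.
rewrite -[- A x]scaleN1r semigroupZ// scaleN1r in h; apply: vcvg_near h; near=> s.
have s0 : 0 <= s by apply: ltW; near: s; exact: nbhs_right_gt.
by rewrite semigroupZ// semigroupB// -!semigroupD// (addrC t s).
Unshelve. all: by end_near. Qed.

Lemma semigroup_vderiv_ex t x : 0 < t -> exists v, vderiv (T^~ x) t v.
Proof.
move=> t0; case: Thol => c [c0 [Tz [TzT _ dT]]].
have tc : in_sector c (real_complex R t) by split=> //=; rewrite normr0 mulr_gt0.
have [v dv] := dT x _ tc; exists v; apply/vcvgP => e e0.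
have [d [d0 dP]] := dv e e0.
near=> s.
have s0 : s != 0 by near: s; exact: (nbhs_dnbhs_neq (0 : R)).
have sd : `|s| < d.
  by near: s; apply: dnbhs0_lt.
(* This keeps [t + s] positive, where [Tz] and [T] agree. *)
have st : `|s| < t.
  by near: s; apply: dnbhs0_lt.
have ns : `|real_complex R s| = real_complex R `|s|.
  by rewrite normc_def /= expr0n addr0 sqrtr_sqr.
have s0' : 0 < `|real_complex R s| by rewrite ns (ltcR 0) normr_gt0.
have sd' : `|real_complex R s| < real_complex R d by rewrite ns ltcR.
have ts : 0 < t + s.
  by move: st; rewrite ltr_norml -subr_gt0 opprK addrC => /andP[].
have := dP _ s0' sd'.
by rewrite -rmorphD -fmorphV !TzT// (addrC s).
Unshelve. all: by end_near. Qed.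

(* Restricting the norm derivative at [t > 0] to increments [s > 0] and using
   [T (s + t) x = T s (T t x)] puts [T t x] in the domain. *)
Lemma semigroup_vderiv t x : 0 < t -> DA (T t x) /\ vderiv (T^~ x) t (- A (T t x)).
Proof.
move=> t0; have [v dv] := semigroup_vderiv_ex x t0.
have [Dt Av] : DA (T t x) /\ A (T t x) = - v.
  apply: generatorI; rewrite opprK.
  have {}dv : vcvg (0 : R)^'+ (fun s : R => s^-1 %:r*: (T (s + t) x - T t x)) v.
    exact: cvg_dnbhs_at_right.
  apply: vcvg_near dv; near=> s; rewrite semigroupD// ltW//.
by split=> //; rewrite Av opprK.
Unshelve. all: by end_near. Qed.

(** Halving [t] writes [iter i A (T t x)] as [T (t / 2)] of some vector, hence as a point of the
    domain, where [A] commutes with [T s]. *)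
Lemma iter_generatorD i s t x : 0 <= s -> 0 < t ->
  iter i A (T (s + t) x) = T s (iter i A (T t x)).
Proof.
elim: i s t => [|i IH] s t s0 t0 /=; first by rewrite semigroupD// ltW.
rewrite IH//; have [|_ ->//] := @generator_semigroup s (iter i A (T t x)) s0.
have t2 : 0 < t / 2 by rewrite divr_gt0.
by rewrite [t in T t]splitr IH ?(ltW t2)//; have [] := semigroup_vderiv (iter i A (T (t / 2) x)) t2.
Qed.

Lemma iter_generator_vderiv i t x : 0 < t ->
  DA (iter i A (T t x)) /\
  vderiv (fun s => iter i A (T s x)) t (- iter i.+1 A (T t x)).
Proof.
move=> t0; have t2 : 0 < t / 2 by rewrite divr_gt0.
have [Dy dy] := semigroup_vderiv (iter i A (T (t / 2) x)) t2.
rewrite -iter_generatorD ?(ltW t2)// -splitr in Dy dy; split=> //.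
apply: vcvg_near dy; near=> s.
(* Near time [t] the curve is the orbit of [iter i A (T (t / 2) x)] near time [t / 2]; this bound
   keeps the shifted time nonnegative. *)
have st : `|s| < t / 2 by near: s; apply: dnbhs0_lt.
have st0 : 0 <= s + t / 2.
  by move: st; rewrite ltr_norml -subr_gt0 opprK => /andP[/ltW].
by rewrite -!iter_generatorD ?(ltW t2)// -addrA -splitr.
Unshelve. all: by end_near. Qed.

(** * Inner products of powers of the generator along an orbit *)

Definition orbit_ip (i j : nat) (x : V) (t : R) : R :=
  rip (iter i A (T t x)) (iter j A (T t x)).

Lemma is_derive_orbit i j x (t : R) : 0 < t ->
  is_derive t 1 (orbit_ip i j x) (- (orbit_ip i.+1 j x t + orbit_ip i j.+1 x t)).
Proof.
move=> t0; have [_ d1] := iter_generator_vderiv i x t0.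
have [_ d2] := iter_generator_vderiv j x t0.
by apply: (is_derive_eq (is_derive_rip d1 d2)); rewrite ripNl ripNr /orbit_ip opprD.
Qed.

Lemma hnorm_orbit_sqr x t : hnorm ip (T t x) ^+ 2 = orbit_ip 0 0 x t.
Proof. exact: hnorm_sqr. Qed.

Lemma orbit_iter i t x : 0 <= t -> (forall k, (k < i)%N -> DA (iter k A x)) ->
  iter i A (T t x) = T t (iter i A x).
Proof.
move=> t0; elim: i => [//|i IH] Dx /=; rewrite IH; last by move=> k ki; exact/Dx/ltnW.
by have [] := generator_semigroup t0 (Dx i (ltnSn i)).
Qed.

(** When [x] lies in the domains involved, the powers of [A] commute with [T t] on [x] itself, and
    strong continuity gives the limits. *)
Lemma orbit_cvg0 i j x : (forall k, (k < i)%N -> DA (iter k A x)) ->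
  (forall k, (k < j)%N -> DA (iter k A x)) ->
  orbit_ip i j x t @[t --> (0 : R)^'+] --> rip (iter i A x) (iter j A x).
Proof.
have C k : (forall l, (l < k)%N -> DA (iter l A x)) ->
    vcvg (0 : R)^'+ (fun t => iter k A (T t x)) (iter k A x).
  move=> Dx; apply: (vcvg_near _ (semigroup_cvg0 (iter k A x))); near=> t.
  by rewrite orbit_iter// ltW//; near: t; exact: nbhs_right_gt.
by move=> Di Dj; apply: cvg_rip; exact: C.
Unshelve. all: by end_near. Qed.

Lemma is_derive_orbit_sqr x (t : R) : 0 < t ->
  is_derive t 1 (orbit_ip 0 0 x) (- 2 * orbit_ip 1 0 x t).
Proof.
move=> t0; apply: (is_derive_eq (is_derive_orbit 0 0 x t0)).
by rewrite /orbit_ip (ripC (iter 0 A _) (iter 1 A _)); ring.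
Qed.

Lemma is_derive2_orbit_sqr x (t : R) : 0 < t ->
  is_derive t 1 (fun s => - 2 * orbit_ip 1 0 x s) (2 * (orbit_ip 2 0 x t + orbit_ip 1 1 x t)).
Proof.
move=> t0; have d := is_derive_orbit 1 0 x t0.
by apply: (is_derive_eq (is_deriveZ (- 2) d)); rewrite /GRing.scale/=; ring.
Qed.

Lemma hnorm_orbit_cvg0 x : hnorm ip (T t x) @[t --> (0 : R)^'+] --> hnorm ip (T 0 x).
Proof.
by case: (TC0) => _ -> _ _; apply: cvg_hnorm; exact: semigroup_cvg0.
Qed.

Lemma orbit_sqr_cvg0 x : orbit_ip 0 0 x t @[t --> (0 : R)^'+] --> orbit_ip 0 0 x 0.
Proof.
by rewrite {2}/orbit_ip; case: (TC0) => _ -> _ _; exact: orbit_cvg0.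
Qed.

(** * Equivalence of condition (i) and log-convexity *)

Lemma cond_iZ x : cond_i ip DA A -> DA x -> DA (A x) ->
  2 * rip (A x) x ^+ 2 <= (rip (A (A x)) x + rip (A x) (A x)) * rip x x.
Proof.
move=> ci Dx DAx; have [->|x0] := eqVneq x 0.
  have z y : rip y 0 = 0 by rewrite ripC /rip ip0l.
  by rewrite !z expr0n/= !mulr0.
have n0 := hnorm_gt0 x0; pose n := hnorm ip x.
have [Dy Ay] := generatorZ n^-1 Dx; have [DAy AAy] := generatorZ n^-1 DAx.
have := ci (n^-1 %:r*: x) Dy; rewrite Ay => /(_ DAy).
rewrite hnormZ ger0_norm ?invr_ge0 ?hnorm_ge0// mulVf ?gt_eqF// => /(_ erefl).
rewrite AAy -!/(rip _ _) hnorm_sqr !(ripZl, ripZr) -(hnorm_sqr x) -/n => h.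
(* Both sides of the goal are homogeneous of degree four in [x], so this factor clears the
   normalisation. *)
have n4 : 0 < n ^+ 4 by rewrite exprn_gt0.
rewrite -(ler_pM2l n4) in h.
move: h; have n0' : n != 0 by rewrite gt_eqF.
have -> : n ^+ 4 * (2 * (n^-1 * (n^-1 * rip (A x) x)) ^+ 2) = 2 * rip (A x) x ^+ 2.
  by field.
have -> : n ^+ 4 * (n^-1 * (n^-1 * rip (A (A x)) x) + n^-1 * (n^-1 * rip (A x) (A x))) =
  (rip (A (A x)) x + rip (A x) (A x)) * n ^+ 2 by field.
by [].
Qed.

Lemma cond_i_orbit x t : cond_i ip DA A -> 0 < t ->
  (- 2 * orbit_ip 1 0 x t) ^+ 2 <=
    orbit_ip 0 0 x t * (2 * (orbit_ip 2 0 x t + orbit_ip 1 1 x t)).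
Proof.
move=> ci t0; have [D1 _] := iter_generator_vderiv 0 x t0.
have [D2 _] := iter_generator_vderiv 1 x t0.
have := cond_iZ ci D1 D2; rewrite /orbit_ip/=; lra.
Qed.

Lemma cond_i_ii : cond_i ip DA A -> cond_ii ip T.
Proof.
move=> ci u0 _ r s t r0 rs st.
(* [A] is a bare function, linear only on its domain; scaling a domain element by 0 gives its value
   at 0. *)
have A0 : A 0 = 0.
  have [D0 _] := iter_generator_vderiv 0 0 (@ltr01 R).
  have [_] := generatorZ 0 D0.
  by rewrite -[real_complex R 0]/(0 : R[i]) !scale0r.
have ge0 (x : R) : 0 <= orbit_ip 0 0 u0 x by exact: rip_ge0.
have lc : orbit_ip 0 0 u0 s <= orbit_ip 0 0 u0 r `^ ((t - s) / (t - r)) *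
    orbit_ip 0 0 u0 t `^ ((s - r) / (t - r)).
  apply: (log_convex_of_second_derivative (is_derive_orbit_sqr u0)
    (is_derive2_orbit_sqr u0) (@orbit_sqr_cvg0 u0)) => //.
  (* Nonnegativity of the second derivative: at a zero of the squared norm the orbit itself is 0;
     elsewhere condition (i) bounds a square by a positive multiple of it. *)
  - move=> x x0; have := cond_i_orbit u0 ci x0.
    have [f0|f0] := eqVneq (orbit_ip 0 0 u0 x) 0.
      have Tx : T x u0 = 0 by apply: hnorm_eq0; rewrite /hnorm -/(rip _ _) -/(orbit_ip 0 0 u0 x) f0 sqrtr0.
      by rewrite /orbit_ip /= Tx !A0 /rip !ip0l /= addr0 mulr0.
    have fp : 0 < orbit_ip 0 0 u0 x by rewrite lt_def f0 ge0.
    by move/(le_trans (sqr_ge0 _)); rewrite pmulr_rge0.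
  - by move=> x x0; exact: cond_i_orbit.
(* Raising to the power one half passes the estimate from the squared norm to the norm. *)
have hE x : hnorm ip (T x u0) = orbit_ip 0 0 u0 x `^ 2^-1 by rewrite powR12_sqrt.
rewrite !hE -!powRrM !(mulrC 2^-1) !(powRrM _ _ 2^-1) -powRM ?powR_ge0//.
by apply: ge0_ler_powR => //; rewrite ?nnegrE ?invr_ge0 ?mulr_ge0 ?powR_ge0 ?ge0.
Qed.

Lemma cond_ii_i : cond_ii ip T -> cond_i ip DA A.
Proof.
move=> cii x Dx DAx x1.
have x0 : x != 0 by apply: contra_eq_neq x1 => ->; rewrite hnorm0 eq_sym oner_neq0.
have disc (t : R) : 0 < t -> (- 2 * orbit_ip 1 0 x t) ^+ 2 <=
    orbit_ip 0 0 x t * (2 * (orbit_ip 2 0 x t + orbit_ip 1 1 x t)).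
  apply: (log_convex_second_derivative (is_derive_orbit_sqr x) (is_derive2_orbit_sqr x)).
  move=> {}t y; rewrite le_eqVlt => /predU1P[<- _|y0 yt].
    by rewrite subr0 addr0 expr2.
  have h0 s : 0 <= hnorm ip (T s x) by exact: hnorm_ge0.
  (* Condition (ii) on the symmetric triple [t - y], [t], [t + y] has both exponents equal to one
     half. *)
  have : hnorm ip (T t x) <= Num.sqrt (hnorm ip (T (t - y) x) * hnorm ip (T (t + y) x)).
    rewrite sqrtrM// -!powR12_sqrt//.
    have := cii x x0 (t - y) t (t + y); rewrite subr_ge0 gtrBl ltrDl y0 (ltW yt) => /(_ isT isT isT).
    have -> : t + y - t = y by ring.
    have -> : t - (t - y) = y by ring.
    have -> : t + y - (t - y) = y * 2 by ring.
    have -> // : y / (y * 2) = 2^-1 by field; rewrite gt_eqF.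
  move=> h; have {}h : hnorm ip (T t x) ^+ 2 <= hnorm ip (T (t - y) x) * hnorm ip (T (t + y) x).
    by rewrite -[leRHS]sqr_sqrtr ?mulr_ge0// ler_pXn2r// nnegrE// sqrtr_ge0.
  rewrite -!hnorm_orbit_sqr -exprMn ler_pXn2r// nnegrE ?mulr_ge0//.
have D1 k : (k < 1)%N -> DA (iter k A x) by case: k.
have D2 k : (k < 2)%N -> DA (iter k A x) by case: k => [|[]].
have D0 k : (k < 0)%N -> DA (iter k A x) by [].
have c10 := orbit_cvg0 D1 D0; have c00 := orbit_cvg0 D0 D0.
have c20 := orbit_cvg0 D2 D0; have c11 := orbit_cvg0 D1 D1.
have : orbit_ip 0 0 x t * (2 * (orbit_ip 2 0 x t + orbit_ip 1 1 x t)) -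
    (- 2 * orbit_ip 1 0 x t) * (- 2 * orbit_ip 1 0 x t) @[t --> (0 : R)^'+] -->
    rip x x * (2 * (rip (A (A x)) x + rip (A x) (A x))) -
    (- 2 * rip (A x) x) * (- 2 * rip (A x) x).
  apply: cvgB; apply: cvgM => //; try (by apply: cvgMr).
  by apply: cvgMr; exact: cvgD.
move/cvgr_to_ge => /(_ 0); rewrite -(hnorm_sqr x) x1 expr1n mul1r => H.
have {}H : 0 <= 2 * (rip (A (A x)) x + rip (A x) (A x)) - (- 2 * rip (A x) x) * (- 2 * rip (A x) x).
  apply: H; near=> t; rewrite subr_ge0 -expr2 disc//.
rewrite hnorm_sqr -!/(rip _ _); lra.
Unshelve. all: by end_near. Qed.

(** * The height function in the positively accretive case *)

Section PositivelyAccretive.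
Context (cii : cond_ii ip T) (Apos : pos_accretive ip DA A) (u0 : V) (u0N0 : u0 != 0).

Let h (t : R) : R := hnorm ip (T t u0).

Lemma orbit0 : T 0 u0 = u0. Proof. by case: TC0 => _ ->. Qed.

(** A zero at [t > 0] would, by (ii) with [r = 0], spread to all of []0, t[], and right-continuity
    would carry it to time 0. *)
Lemma cond_ii_orbit_gt0 t : 0 <= t -> 0 < h t.
Proof.
move=> t0; rewrite lt_def hnorm_ge0 andbT; apply/negP => /eqP ht0.
have h00 : 0 < h 0 by rewrite /h orbit0 hnorm_gt0.
have {t0} tp : 0 < t.
  by rewrite lt_def t0 andbT; apply: contra_eq_neq ht0 => ->; rewrite gt_eqF.
suff : h 0 <= 0 by rewrite leNgt h00.
apply: (cvgr_to_le (@hnorm_orbit_cvg0 u0)); near=> s.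
have s0 : 0 < s by near: s; exact: nbhs_right_gt.
have st : s < t by near: s; exact: nbhs_right_lt.
have := cii u0N0 (lexx 0) s0 st; rewrite -!/(h _) ht0 !subr0 powR0 ?mulr0//.
(* A power of 0 is 0 only for a nonzero exponent, here [s / t]. *)
by rewrite mulf_neq0 ?invr_neq0 ?gt_eqF.
Unshelve. all: by end_near. Qed.

(** Accretivity and the numerical range concern unit vectors; normalising the orbit exhibits the
    quotient as the real part of a point of the numerical range. *)
Lemma orbit_normalized t : 0 < t ->
  [/\ DA ((h t)^-1 %:r*: T t u0), hnorm ip ((h t)^-1 %:r*: T t u0) = 1 &
  rip (A ((h t)^-1 %:r*: T t u0)) ((h t)^-1 %:r*: T t u0) = orbit_ip 1 0 u0 t / h t ^+ 2].
Proof.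
move=> t0; have ht0 := cond_ii_orbit_gt0 (ltW t0).
have [Dt _] := semigroup_vderiv u0 t0.
have [Dy Ay] := generatorZ (h t)^-1 Dt; split => //.
  by rewrite hnormZ ger0_norm ?invr_ge0 ?hnorm_ge0// mulVf ?gt_eqF.
rewrite Ay ripZl ripZr /orbit_ip/= mulrA mulrC -invfM expr2; congr (_ / _).
Qed.

Lemma orbit_accretive_gt0 t : 0 < t -> 0 < orbit_ip 1 0 u0 t.
Proof.
move=> t0; have [Dy y1 E] := orbit_normalized t0.
have := Apos Dy y1; rewrite -/(rip _ _) E pmulr_lgt0// invr_gt0 exprn_gt0//.
exact/cond_ii_orbit_gt0/ltW.
Qed.

Lemma is_derive_hnorm_orbit (t : R) : 0 < t ->
  is_derive t 1 h (- (orbit_ip 1 0 u0 t * (h t)^-1)).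
Proof.
move=> t0; have ht0 := cond_ii_orbit_gt0 (ltW t0).
have f0 : 0 < orbit_ip 0 0 u0 t by rewrite -hnorm_orbit_sqr exprn_gt0.
have d1 := is_derive_orbit_sqr u0 t0; have d2 := is_derive1_sqrt f0.
apply: (is_derive_eq (is_derive1_comp d2 d1)).
rewrite -[Num.sqrt _]/(h t); field.
by rewrite gt_eqF.
Qed.

Lemma hnorm_orbit_decr (s t : R) : 0 <= s -> s < t -> h t < h s.
Proof.
move=> s0 st; have [c /andP[sc ct] E] := MVT_oy is_derive_hnorm_orbit (@hnorm_orbit_cvg0 u0) s0 st.
have c0 : 0 < c by exact: le_lt_trans sc.
rewrite -subr_lt0 E pmulr_llt0 ?subr_gt0// oppr_lt0 divr_gt0 ?orbit_accretive_gt0//.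
exact/cond_ii_orbit_gt0/ltW.
Qed.

Lemma hnorm_orbit_strict_convex (r s t : R) : 0 <= r -> r < s -> s < t ->
  h s * (t - r) < (t - s) * h r + (s - r) * h t.
Proof.
move=> r0 rs st; have rt := lt_trans rs st.
have tr : 0 < t - r by rewrite subr_gt0.
have -> : (t - s) * h r + (s - r) * h t =
    ((t - s) / (t - r) * h r + (s - r) / (t - r) * h t) * (t - r).
  by field; rewrite gt_eqF.
rewrite ltr_pM2r//; apply: (le_lt_trans (cii u0N0 r0 rs st)).
apply: powR_mul_lt_conv.
- exact: cond_ii_orbit_gt0.
- by apply: cond_ii_orbit_gt0; rewrite ltW// (le_lt_trans r0).
- by rewrite gt_eqF// hnorm_orbit_decr.
- by rewrite divr_gt0 ?subr_gt0.
- by rewrite divr_gt0 ?subr_gt0.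
- by field; rewrite gt_eqF.
Qed.

Lemma derivable_hnorm_orbit (t : R) : 0 < t -> derivable h t 1.
Proof. by move=> t0; apply: (@ex_derive _ _ _ _ _ _ _ (is_derive_hnorm_orbit t0)). Qed.

Lemma derive1_hnorm_orbit (t : R) : 0 < t -> derive1 h t = - (orbit_ip 1 0 u0 t / h t).
Proof. by move=> t0; rewrite derive1E; have := is_derive_hnorm_orbit t0 => ?; rewrite derive_val. Qed.

Let d0 := ereal_inf [set (derive1 h t)%:E | t in `]0, +oo[%classic].

Lemma d0_le_derive1 (t : R) : 0 < t -> (d0 <= (derive1 h t)%:E)%E.
Proof. by move=> t0; apply: ereal_inf_lbound; exists t; rewrite //= in_itv/= t0. Qed.

Lemma hnorm_orbit_slope_cvg :
  ((h t - h 0) / t)%:E @[t --> 0^'+] --> d0.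
Proof.
apply: (convex_right_slope_cvg derivable_hnorm_orbit (@hnorm_orbit_cvg0 u0)).
by move=> r s t r0 rs st; exact/ltW/hnorm_orbit_strict_convex.
Qed.

Lemma hnorm_orbit_slope_le0 : (d0 <= 0)%E.
Proof.
apply: (le_trans (d0_le_derive1 ltr01)).
rewrite lee_fin derive1_hnorm_orbit// oppr_le0 ltW// divr_gt0 ?orbit_accretive_gt0//.
exact: cond_ii_orbit_gt0.
Qed.

(** For finite [m] the derivative at [t] is at most [- (m * h t)], and [h t] tends to 1. The case
    [m = -oo] is trivial, and [m = +oo] is excluded by the orbit at time 1. *)
Lemma hnorm_orbit_slope_le_lb : hnorm ip u0 = 1 -> (d0 <= - num_range_lb ip DA A)%E.
Proof.
move=> u1; set m := num_range_lb ip DA A.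
have mle (t : R) : 0 < t -> (m <= (orbit_ip 1 0 u0 t / h t ^+ 2)%:E)%E.
  move=> t0; have [Dy y1 E] := orbit_normalized t0.
  by apply: ereal_inf_lbound; exists ((h t)^-1 %:r*: T t u0) => //; rewrite -/(rip _ _) E.
move: mle; case: m => [m||] mle; last by rewrite leey.
  have d0le (t : R) : 0 < t -> (d0 <= (- (m * h t))%:E)%E.
    move=> t0; have ht0 := cond_ii_orbit_gt0 (ltW t0).
    apply: (le_trans (d0_le_derive1 t0)).
    rewrite lee_fin derive1_hnorm_orbit// lerN2 ler_pdivlMr//.
    by have := mle t t0; rewrite lee_fin ler_pdivlMr ?exprn_gt0// expr2 mulrA.
  move: d0le; case: d0 => [d|/(_ _ ltr01)//|_]; last by rewrite leNye.
  move=> d0le; rewrite lee_fin.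
  have : - (m * h t) @[t --> (0 : R)^'+] --> - m.
    rewrite -[X in _ --> - X]mulr1 -u1 -{1}orbit0.
    by apply: cvgN; apply: cvgMr; exact: hnorm_orbit_cvg0.
  move/cvgr_to_ge; apply; near=> t; rewrite -lee_fin d0le//.
by have := mle 1 ltr01; rewrite leNgt ltry.
Unshelve. all: by end_near. Qed.

Lemma derive1_hnorm_orbit_cvg0 : DA u0 -> hnorm ip u0 = 1 ->
  derive1 h t @[t --> (0 : R)^'+] --> - rip (A u0) u0.
Proof.
move=> Du u1.
have D1 k : (k < 1)%N -> DA (iter k A u0) by case: k.
have D0 k : (k < 0)%N -> DA (iter k A u0) by [].
have h01 : h 0 = 1 by rewrite /h orbit0.
have hV : (h t)^-1 @[t --> (0 : R)^'+] --> (h 0)^-1.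
  by apply: cvgV; [rewrite h01 oner_neq0|exact: hnorm_orbit_cvg0].
rewrite h01 invr1 in hV.
have lim : - (orbit_ip 1 0 u0 t / h t) @[t --> (0 : R)^'+] --> - rip (A u0) u0.
  by rewrite -[rip _ _]mulr1; apply: cvgN; apply: cvgM => //; exact: orbit_cvg0 D1 D0.
apply: cvg_trans lim; apply: near_eq_cvg; near=> t.
rewrite derive1_hnorm_orbit//.
Unshelve. all: by end_near. Qed.

(** Each slope from 0 to [t] is a value of the derivative between them, so the slopes share its
    limit at 0. *)
Lemma hnorm_orbit_slope_domain : DA u0 -> hnorm ip u0 = 1 ->
  d0 = (- rip (A u0) u0)%:E.
Proof.
move=> Du u1; apply: (cvg_unique _ hnorm_orbit_slope_cvg); first exact: ereal_hausdorff.
apply: cvg_EFin; first exact: nearW.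
apply/cvgrPdist_lt => e e0.
have /cvgrPdist_lt/(_ e e0) := derive1_hnorm_orbit_cvg0 Du u1.
rewrite near_withinE => -[d /= dp dP].
near=> t.
have t0 : 0 < t by near: t; exact: nbhs_right_gt.
have td : t < d by near: t; exact: nbhs_right_lt.
have [c /andP[c0 ct] E] := MVT_oy is_derive_hnorm_orbit (@hnorm_orbit_cvg0 u0) (lexx 0) t0.
rewrite /= -/(h 0) E subr0 mulfK ?gt_eqF// -derive1_hnorm_orbit//; apply: dP => //=.
by rewrite sub0r normrN gtr0_norm// (lt_trans ct).
Unshelve. all: by end_near. Qed.

(* On [t > 0] these functions form an algebra stable under differentiation. *)
Inductive orbit_algebra : (R -> R) -> Prop :=
| OrbitNorm : orbit_algebra h
| OrbitNormV : orbit_algebra (fun t => (h t)^-1)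
| OrbitIp i j : orbit_algebra (orbit_ip i j u0)
| OrbitOpp g : orbit_algebra g -> orbit_algebra (fun t => - g t)
| OrbitAdd g k : orbit_algebra g -> orbit_algebra k -> orbit_algebra (fun t => g t + k t)
| OrbitMul g k : orbit_algebra g -> orbit_algebra k -> orbit_algebra (fun t => g t * k t).

(** The inverse of [h] is among the generators because it occurs in the derivative of [h]; its own
    derivative is again a product of generators, up to sign. *)
Lemma orbit_algebra_derive g : orbit_algebra g ->
  exists2 g1, orbit_algebra g1 & forall t : R, 0 < t -> is_derive t 1 g (g1 t).
Proof.
have Fh1 : orbit_algebra (fun t => - (orbit_ip 1 0 u0 t * (h t)^-1)).
  by apply/OrbitOpp/OrbitMul; [exact: OrbitIp|exact: OrbitNormV].
elim=> [||i j|{}g Fg [g1 Fg1 dg]|{}g k Fg [g1 Fg1 dg] Fk [k1 Fk1 dk]|{}g k Fg [g1 Fg1 dg] Fk [k1 Fk1 dk]].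
- by exists (fun t => - (orbit_ip 1 0 u0 t * (h t)^-1)) => //; exact: is_derive_hnorm_orbit.
- exists (fun t => - ((h t)^-1 * (h t)^-1 * - (orbit_ip 1 0 u0 t * (h t)^-1))).
    by apply/OrbitOpp/OrbitMul => //; apply: OrbitMul; exact: OrbitNormV.
  move=> t t0; have ht0 := lt0r_neq0 (cond_ii_orbit_gt0 (ltW t0)).
  apply: (is_derive_eq (is_deriveV ht0 (is_derive_hnorm_orbit t0))).
  by rewrite /GRing.scale/= expr2 invfM mulNr.
- exists (fun t => - (orbit_ip i.+1 j u0 t + orbit_ip i j.+1 u0 t)).
    by apply/OrbitOpp/OrbitAdd; exact: OrbitIp.
  exact: is_derive_orbit.
- exists (fun t => - g1 t); first exact: OrbitOpp.
  by move=> t t0; have := dg t t0; exact: is_deriveN.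
- exists (fun t => g1 t + k1 t); first exact: OrbitAdd.
  by move=> t t0; have := dg t t0; have := dk t t0 => ? ?; exact: is_deriveD.
- exists (fun t => g t * k1 t + k t * g1 t).
    by apply: OrbitAdd; exact: OrbitMul.
  by move=> t t0; have := dg t t0; have := dk t t0 => ? ?; exact: is_deriveM.
Qed.

Lemma hnorm_orbit_smooth n (t : R) : 0 < t -> derivable (derive1n n h) t 1.
Proof.
by apply: (derivable_derive1n_family orbit_algebra_derive); exact: OrbitNorm.
Qed.
End PositivelyAccretive.
End Semigroup.
End RealInnerProduct.

Theorem theorem2p5 (R : realType) (V : lmodType R[i]) (ip : V -> V -> R[i])
    (T : R -> V -> V) (DA : set V) (A : V -> V) :
  is_hilbert ip ->
  C0_semigroup ip T -> unif_bounded ip T -> holomorphic_sg ip T ->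
  generator ip T DA A ->
  (cond_i ip DA A <-> cond_ii ip T) /\
  (cond_i ip DA A -> cond_ii ip T -> pos_accretive ip DA A ->
   forall u0 : V, u0 != 0 ->
   let h := fun t : R => hnorm ip (T t u0) in
   [/\ (* strictly decreasing on [0, oo[ *)
       forall s t : R, 0 <= s -> s < t -> h t < h s,
       (* strictly convex on [0, oo[ *)
       forall r s t : R, 0 <= r -> r < s -> s < t ->
         h s * (t - r) < (t - s) * h r + (s - r) * h t,
       (* h'(t) exists for t > 0 *)
       forall t : R, 0 < t -> derivable h t 1
     & exists d0 : \bar R,
       [/\ (* right derivative at 0, with value in [-oo, 0] *)
           ((h t - h 0) / t)%:E @[t --> 0^'+] --> d0,
           (d0 <= 0)%E,
           hnorm ip u0 = 1 ->
             d0 = ereal_inf [set (derive1 h t)%:E | t in `]0, +oo[%classic] /\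
             (d0 <= - num_range_lb ip DA A)%E
         & DA u0 -> hnorm ip u0 = 1 ->
             [/\ d0 = (- complex.Re (ip (A u0) u0))%:E,
                 (* C^1 on [0, oo[ : h' is right-continuous at 0 *)
                 derive1 h t @[t --> 0^'+] --> - complex.Re (ip (A u0) u0)
               & (* C^oo on ]0, oo[ *)
                 forall (n : nat) (t : R), 0 < t -> derivable (derive1n n h) t 1]]]).
Proof.
move=> [ipP _] TC0 _ Thol AT; split.
  by split; [exact: (cond_i_ii ipP TC0 Thol AT)|exact: (cond_ii_i ipP TC0 Thol AT)].
move=> _ cii Apos u0 u0N0 h; split.
- exact: (hnorm_orbit_decr ipP TC0 Thol AT cii Apos u0N0).
- exact: (hnorm_orbit_strict_convex ipP TC0 Thol AT cii Apos u0N0).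
- exact: (derivable_hnorm_orbit ipP TC0 Thol AT cii u0N0).
- exists (ereal_inf [set (derive1 h t)%:E | t in `]0, +oo[%classic]); split.
  + exact: (hnorm_orbit_slope_cvg ipP TC0 Thol AT cii Apos u0N0).
  + exact: (hnorm_orbit_slope_le0 ipP TC0 Thol AT cii Apos u0N0).
  + by move=> u1; split=> //; exact: (hnorm_orbit_slope_le_lb ipP TC0 Thol AT cii u0N0 u1).
  + move=> Du u1; split.
    * exact: (hnorm_orbit_slope_domain ipP TC0 Thol AT cii Apos u0N0 Du u1).
    * exact: (derive1_hnorm_orbit_cvg0 ipP TC0 Thol AT cii u0N0 Du u1).
    * exact: (hnorm_orbit_smooth ipP TC0 Thol AT cii u0N0).
Qed.
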